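(* Let $F$ be a partition (a hypergraph with pairwise disjoint edges) with $p=v(F)$ and $q=e(F)>1$, and let $H$ be an $F$-free hypergraph, not necessarily simple. Then $$ i(H)<(q-1)\cdot v(H)+e(H)\cdot\beta(q,2p,e(H)),$$ where $\beta(k,l,n)=k\,2^{kl-3}(10k)^{2\alpha(n)^{kl-4}+8\alpha(n)^{kl-5}}$.
   Context: A hypergraph $H=(E_i:i\in I)$ is a finite list of finite nonempty subsets of $\mathbb{N}$ (repetitions allowed); $v(H)=|\bigcup_iE_i|$, $e(H)=|I|$, $i(H)=\sum_i|E_i|$. $H$ contains $H'=(E'_i:i\in I')$ if there exist an increasing injection $\phi:\bigcup H'\to\bigcup H$ and an injection $f:I'\to I$ with $v\in E'_i\Rightarrow\phi(v)\in E_{f(i)}$; $H$ is $F$-free if it does not contain $F$. The Ackermann function: $F_1(n)=2n$, $F_{i+1}(n)=F_i(F_i(\cdots F_i(1)\cdots))$ with $n$ iterations, $A(n)=F_n(n)$; $\alpha(n)=\min\{m:A(m)\ge n\}$.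
   Formalization: H is assumed to have at least one edge (e(H) ≥ 1): for the empty hypergraph, which is F-free, i(H) = v(H) = e(H) = 0 and the strict inequality would read 0 < 0. *)

(* Defs.v *)
From HB Require Import structures.
From mathcomp Require Import all_boot finmap.

Set Implicit Arguments.
Unset Strict Implicit.
Unset Printing Implicit Defensive.

(* The edges form a family indexed by a finite set, so repetitions are
   allowed. *)
Record hypergraph := Hypergraph {
  hindex : finType;
  hedge :> hindex -> {fset nat};
  hedge_neq0 : forall i, hedge i != fset0 }.

Definition hvert (H : hypergraph) : {fset nat} :=
  (\bigcup_(i in hindex H) H i)%fset.

Definition hv (H : hypergraph) : nat := #|` hvert H|%fset.
Definition he (H : hypergraph) : nat := #|hindex H|.
Definition hi (H : hypergraph) : nat := \sum_(i : hindex H) #|` H i|%fset.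

Definition hcontains (H H' : hypergraph) : Prop :=
  exists (phi : hvert H' -> hvert H) (f : hindex H' -> hindex H),
    [/\ forall x y : hvert H', val x < val y -> val (phi x) < val (phi y),
        injective f
      & forall (i : hindex H') (v : hvert H'),
          val v \in H' i -> val (phi v) \in H (f i)].

Definition hfree (F H : hypergraph) : Prop := ~ hcontains H F.

Definition is_partition (F : hypergraph) : Prop :=
  forall i j : hindex F, i != j -> [disjoint F i & F j]%fset.

(* [ackF i] is F_i for i >= 1; the value at i = 0 is junk and never used. *)
Fixpoint ackF (i : nat) : nat -> nat :=
  match i with
  | 0 => id
  | i'.+1 => if i' is 0 then fun n => 2 * n else fun n => iter n (ackF i') 1
  end.

Definition ackA (n : nat) : nat := ackF n n.

Lemma ackF_gt (i n : nat) : 0 < n -> n < ackF i.+1 n.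
Proof.
elim: i n => [|i IHi] n n_gt0; first by rewrite /= mul2n -addnn -ltn_subLR ?subnn.
change (n < iter n (ackF i.+1) 1); elim: {n_gt0} n => // n IHn.
have pos := leq_ltn_trans (leq0n n) IHn.
by rewrite iterS; apply: (leq_ltn_trans IHn); apply: IHi.
Qed.

Lemma ackA_unbounded (n : nat) : exists m, (0 < m) && (n <= ackA m).
Proof. by exists n.+1; rewrite /= ltnW // ltnW // ackF_gt. Qed.

(* Since F_0 is undefined, the minimum is over m >= 1. *)
Definition alpha (n : nat) : nat := ex_minn (ackA_unbounded n).

(* The subtractions are truncated; they are exact as soon as k * l >= 5. *)
Definition beta (k l n : nat) : nat :=
  k * 2 ^ (k * l - 3)
  * (10 * k) ^ (2 * alpha n ^ (k * l - 4) + 8 * alpha n ^ (k * l - 5)).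

(* Main.v *)
Require Import Defs.
From mathcomp Require Import all_boot finmap zify.

(** Read [H] as a word of blocks, one for each vertex in increasing order, the
    block of a vertex being the set of edges ("letters") through it.  Suppose
    that some [q] edges all occur in each of [p] successive intervals of
    vertices.  Since the edges of [F] are disjoint, the [j]-th vertex of [F] can
    then be sent into the [j]-th interval, inside any prescribed one of these
    edges, so [H] contains [F].  Hence the word has no such "(q,p)-formation".

    Words without [(q,s)]-formations are bounded by induction on [s].  Cut the
    word into groups: a letter that also occurs in another group occurs before
    or after the given one, so inside this group these letters form two words
    without [(q,s-1)]-formations; the word of groups is itself
    [(q,s)]-formation-free, and so are the local letters of each group.  With
    the group size chosen along the Ackermann hierarchy this gives
    [weight <= D_s (letters + blocks)], where [D_s] is about [(8 D_(s-1))^alpha].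

    The number of blocks is then removed by cutting the word greedily into
    segments that barely contain a [(q,s-1)]-formation: there are at most as
    many of them as letters. *)

Set Implicit Arguments.
Unset Strict Implicit.
Unset Printing Implicit Defensive.

(** * Words of blocks, their letters and weight *)

Section Blocks.
Variable T : finType.
Implicit Types (w u v : seq {set T}) (ws : seq (seq {set T})) (R X : {set T}).

Definition letters w : {set T} := \bigcup_(B <- w) B.
Definition weight w : nat := \sum_(B <- w) #|B|.
Definition restr X w : seq {set T} := [seq B :&: X | B <- w].

Lemma letters_cat u v : letters (u ++ v) = letters u :|: letters v.
Proof. by rewrite /letters big_cat. Qed.

Lemma letters_cons B w : letters (B :: w) = B :|: letters w.
Proof. by rewrite /letters big_cons. Qed.

Lemma letters_flatten ws : letters (map letters ws) = letters (flatten ws).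
Proof.
elim: ws => [|w ws IH] /=; first by [].
by rewrite letters_cons letters_cat IH.
Qed.

Lemma letters_restr X w : letters (restr X w) = letters w :&: X.
Proof. by rewrite /letters big_map big_distrl. Qed.

Lemma sub_letters B w : B \in w -> B \subset letters w.
Proof.
by case/splitPr => u v; rewrite letters_cat letters_cons setUCA subsetUl.
Qed.

Lemma lettersP w x : reflect (exists2 B, B \in w & x \in B) (x \in letters w).
Proof.
apply: (iffP idP) => [|[B /sub_letters/subsetP]]; last exact.
elim: w => [|B w IH]; first by rewrite /letters big_nil inE.
rewrite letters_cons => /setUP[xB|/IH[C wC xC]].
  by exists B; rewrite ?mem_head.
by exists C; rewrite // mem_behead.
Qed.

Lemma letters_flattenP ws x :
  reflect (exists2 w, w \in ws & x \in letters w) (x \in letters (flatten ws)).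
Proof.
rewrite -letters_flatten; apply: (iffP (lettersP _ _)) => [[B]|[w ws_w xw]].
  by case/mapP=> w ws_w ->; exists w.
by exists (letters w); rewrite // map_f.
Qed.

Lemma weight_cat u v : weight (u ++ v) = weight u + weight v.
Proof. by rewrite /weight big_cat. Qed.

Lemma weight_flatten ws : weight (flatten ws) = \sum_(w <- ws) weight w.
Proof.
elim: ws => [|w ws IH]; first by rewrite /weight !big_nil.
by rewrite big_cons weight_cat IH.
Qed.

Lemma weight_restrC X w : weight w = weight (restr X w) + weight (restr (~: X) w).
Proof.
rewrite /weight !big_map -big_split /=; apply: eq_bigr => B _.
by rewrite -setDE cardsID.
Qed.

Lemma weight_le_card_mul (b : nat) w :
  (forall B, B \in w -> #|B| <= b) -> weight w <= b * size w.
Proof.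
move=> le_b; rewrite /weight mulnC -sum1_size big_distrl /= !big_seq.
by apply: leq_sum => B /le_b; rewrite mul1n.
Qed.

Lemma weight_le_letters w : weight w <= #|letters w| * size w.
Proof. by apply: weight_le_card_mul => B /sub_letters/subset_leq_card. Qed.

(** * Formations and words that avoid them *)

(** Intervals are cut off as successive prefixes, and blocks may be left over at the end. Ranging
    over the finitely many cut positions makes this a boolean, so that freeness can be tested by the
    greedy cut. *)
Fixpoint formation s R w : bool :=
  if s is s'.+1 then
    [exists i : 'I_(size w).+1,
       (R \subset letters (take i w)) && formation s' R (drop i w)]
  else true.

Lemma formationSP s R w :
  reflect (exists u v, [/\ w = u ++ v, R \subset letters u & formation s R v])
          (formation s.+1 R w).
Proof.
apply: (iffP existsP) => [[i /andP[Ri fi]]|[u [v [-> Ru fv]]]].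
  by exists (take i w), (drop i w); rewrite cat_take_drop.
have lt_u : size u < (size (u ++ v)).+1 by rewrite size_cat ltnS leq_addr.
by exists (Ordinal lt_u); rewrite /= take_size_cat // drop_size_cat // Ru.
Qed.

Lemma formation_catl s R u v : formation s R v -> formation s R (u ++ v).
Proof.
case: s => // s /formationSP[v1 [v2 [-> Rv1 fv2]]].
apply/formationSP; exists (u ++ v1), v2; split; rewrite ?catA //.
by rewrite letters_cat (subset_trans Rv1) ?subsetUr.
Qed.

Lemma formation_catr s R u v : formation s R u -> formation s R (u ++ v).
Proof.
elim: s u => // s IH u /formationSP[u1 [u2 [-> Ru1 fu2]]].
by apply/formationSP; exists u1, (u2 ++ v); rewrite catA IH.
Qed.

Lemma formation_consl s R u v :
  R \subset letters u -> formation s R v -> formation s.+1 R (u ++ v).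
Proof. by move=> Ru fv; apply/formationSP; exists u, v. Qed.

Lemma formation_consr s R u v :
  R \subset letters v -> formation s R u -> formation s.+1 R (u ++ v).
Proof.
move=> Rv; elim: s u => [|s IH] u.
  by move=> _; apply/formation_catl/formationSP; exists v, [::]; rewrite cats0.
case/formationSP=> u1 [u2 [-> Ru1 fu2]].
by apply/formationSP; exists u1, (u2 ++ v); rewrite catA IH.
Qed.

Lemma formation_sub_letters s R w :
  formation s.+1 R w -> R \subset letters w.
Proof.
case/formationSP=> u [v [-> Ru _]].
by rewrite letters_cat (subset_trans Ru) ?subsetUl.
Qed.

Lemma formation_restr s R X w : formation s R (restr X w) -> formation s R w.
Proof.
elim: s w => // s IH w /existsP[i /andP[]].
rewrite -map_take -map_drop letters_restr => /subsetIP[Ri _] /IH fi.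
by rewrite -(cat_take_drop i w) formation_consl.
Qed.

Lemma formation_flatten s R ws :
  formation s R (map letters ws) -> formation s R (flatten ws).
Proof.
elim: s ws => // s IH ws /existsP[i /andP[]].
rewrite -map_take -map_drop letters_flatten => Ri /IH fi.
by rewrite -(cat_take_drop i ws) flatten_cat formation_consl.
Qed.

(** The intervals are disjoint and ordered, so picking in each one a block that contains the
    prescribed letter yields increasing positions. The letter may change from interval to
    interval. *)
Lemma formation_choice (c : nat -> T) s R w :
    (forall j, c j \in R) -> formation s R w ->
  exists pos : nat -> nat,
    [/\ forall i j, i < j < s -> pos i < pos j,
        forall j, j < s -> pos j < size w
      & forall j, j < s -> c j \in nth set0 w (pos j)].
Proof.
elim: s c w => [|s IH] c w cR; first by exists id; split=> // i j; rewrite andbF.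
case/formationSP=> u [v [-> Ru fv]].
have [pos [pos_mono pos_lt pos_in]] := IH (c \o S) v (fun j => cR j.+1) fv.
have /lettersP[B uB cB] : c 0 \in letters u by apply: (subsetP Ru).
exists (fun j => if j is j'.+1 then size u + pos j' else index B u).
have lt_iB : index B u < size u by rewrite index_mem.
split=> [[|i] [|j] //|[|j]|[|j]] /=; rewrite ?ltnS ?size_cat ?ltn_add2l.
- by move=> _; rewrite ltn_addr.
- exact: pos_mono.
- by move=> _; rewrite ltn_addr.
- exact: pos_lt.
- by move=> _; rewrite nth_cat lt_iB nth_index.
- by move=> lt_js; rewrite nth_cat ltnNge leq_addr addKn pos_in.
Qed.

Variable r : nat.

Definition ffree s w := [forall R : {set T}, (#|R| == r) ==> ~~ formation s R w].

Lemma ffreeP s w :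
  reflect (forall R, #|R| = r -> ~~ formation s R w) (ffree s w).
Proof.
by apply: (iffP 'forall_implyP) => free R; [move/eqP/free | move/eqP; apply: free].
Qed.

Lemma ffree_restr s X w : ffree s w -> ffree s (restr X w).
Proof.
move/ffreeP=> free; apply/ffreeP=> R /free.
exact/contra/formation_restr.
Qed.

Lemma ffree_contract s ws : ffree s (flatten ws) -> ffree s (map letters ws).
Proof.
move/ffreeP=> free; apply/ffreeP=> R /free.
exact/contra/formation_flatten.
Qed.

Lemma ffree_infix s u w v : ffree s (u ++ w ++ v) -> ffree s w.
Proof.
move/ffreeP=> free; apply/ffreeP=> R /free.
by apply: contra => fw; apply/formation_catl/formation_catr.
Qed.

Lemma ffree1_card w : ffree 1 w -> #|letters w| < r.
Proof.
move/ffreeP=> free; rewrite ltnNge; apply/negP => le_r.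
have [R Rw cR] : exists2 R : {set T}, R \subset letters w & #|R| = r.
  have [A] := card_geqP le_r.
  case=> uA sA sub; exists [set x in A]; last first.
    by rewrite cardsE -sA; apply/card_uniqP.
  by apply/subsetP=> x; rewrite inE; apply: sub.
by move/negP: (free R cR); apply; apply/formationSP; exists w, [::]; rewrite cats0.
Qed.

(** * Cutting into groups: local and global letters *)

Definition global ws : {set T} :=
  [set x | 1 < count (fun w => x \in letters w) ws].

Lemma global_sub ws : global ws \subset letters (flatten ws).
Proof.
apply/subsetP=> x; rewrite inE => /ltnW; rewrite -has_count => /hasP xws.
exact/letters_flattenP.
Qed.

Lemma letters_global ws :
  letters (restr (global ws) (map letters ws)) = global ws.
Proof. by rewrite letters_restr letters_flatten (setIidPr (global_sub ws)). Qed.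

(** A letter outside [global ws] lies in at most one group, so the local counts add up without
    repetition. *)
Lemma card_local ws :
  \sum_(w <- ws) #|letters w :&: ~: global ws| + #|global ws|
    <= #|letters (flatten ws)|.
Proof.
set G := global ws; set L := letters _.
rewrite -(cardsID G L) (setIidPr (global_sub ws)) addnC leq_add2l.
have -> : \sum_(w <- ws) #|letters w :&: ~: G|
        = \sum_(x in ~: G) count (fun w => x \in letters w) ws.
  under [RHS]eq_bigr => x _ do rewrite -sum1_count big_mkcond /=.
  rewrite exchange_big /=; apply: eq_bigr => w _.
  rewrite -big_mkcondr /= sum1_card; apply: eq_card => x.
  by rewrite in_setI andbC unfold_in.
rewrite -sum1_card setDE big_mkcond [leqRHS]big_mkcond /=.
apply: leq_sum => x _; rewrite !inE -leqNgt.
case: (leqP (count _ _) 1) => [le1|]; last by rewrite andbF.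
rewrite andbT; case: ifP => // /negbT xL.
rewrite leqNgt -has_count; apply: contra xL => /hasP xws.
exact/letters_flattenP.
Qed.

Lemma weight_group (M s D : nat) ws w :
    (forall u, ffree s.+1 u -> size u <= M ->
       weight u <= D * (#|letters u| + size u)) ->
    ffree s.+2 (flatten ws) -> w \in ws -> size w <= M ->
  weight w <= weight (restr (~: global ws) w)
             + D * (#|letters w :&: global ws| + 2 * size w).
Proof.
move=> IH free ws_w le_wM; set G := global ws.
rewrite (weight_restrC G) addnC leq_add2l.
case/splitPr: ws_w @G free => pre post G; rewrite flatten_cat /= => free.
set P := letters (flatten pre).
(* Global letters in [P] allow one more interval on the left, taken from the earlier groups. The
   others recur in [post] and allow one more on the right. So [IH] applies to each of the two
   parts. *)
rewrite (weight_restrC P).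
have memG x : x \in letters w -> x \in G -> x \notin P ->
    x \in letters (flatten post).
  move=> xw; rewrite inE count_cat /= xw => c1 xP; move: c1.
  have -> : count (fun w => x \in letters w) pre = 0.
    apply/eqP; rewrite -leqn0 leqNgt -has_count; apply: contra xP => /hasP xpre.
    exact/letters_flattenP.
  by rewrite ltnS -has_count => /hasP xpost; apply/letters_flattenP.
have le1 : weight (restr P (restr G w)) <=
    D * (#|letters (restr P (restr G w))| + size (restr P (restr G w))).
  apply: IH; last by rewrite !size_map.
  apply/ffreeP=> R /(ffreeP _ _ free); apply: contra => fR.
  have := formation_sub_letters fR; rewrite letters_restr => /subsetIP[_ RP].
  apply: formation_consl => //; apply: formation_catr.
  exact/formation_restr/formation_restr/fR.
have le2 : weight (restr (~: P) (restr G w)) <=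
    D * (#|letters (restr (~: P) (restr G w))| + size (restr (~: P) (restr G w))).
  apply: IH; last by rewrite !size_map.
  apply/ffreeP=> R /(ffreeP _ _ free); apply: contra => fR.
  have RQ : R \subset letters (flatten post).
    apply/subsetP=> x /(subsetP (formation_sub_letters fR)).
    by rewrite !letters_restr !in_setI in_setC => /andP[/andP[]]; apply: memG.
  apply: formation_catl; apply: formation_consr => //.
  exact/formation_restr/formation_restr/fR.
apply: (leq_trans (leq_add le1 le2)); rewrite -mulnDr leq_mul2l.
rewrite !letters_restr !size_map -[letters w :&: G :&: ~: P]setDE.
by rewrite addnACA cardsID addnn mul2n leqnn orbT.
Qed.

Lemma chunks (A : eqType) (t : nat) (xs : seq A) : 0 < t ->
  exists xss : seq (seq A),
    [/\ flatten xss = xs, forall ys, ys \in xss -> size ys <= t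
      & size xss * t < size xs + t].
Proof.
move=> t_gt0; have [n le_n] := ubnP (size xs); elim: n xs le_n => // n IH xs le_n.
have [le_wt|lt_tw] := leqP (size xs) t.
  case: xs le_wt {le_n} => [|x xs] le_wt; first by exists [::].
  exists [:: x :: xs]; split=> [|ys|]; rewrite /= ?cats0 //; last lia.
  by rewrite inE => /eqP->.
have [|xss [def_xs le_t lt_xss]] := IH (drop t xs); first by rewrite size_drop; lia.
exists (take t xs :: xss); split=> [|ys|] /=; first by rewrite def_xs cat_take_drop.
  by rewrite inE => /orP[/eqP->|/le_t//]; rewrite size_take lt_tw.
by move: lt_xss; rewrite size_drop; nia.
Qed.

(** * Recursion along the Ackermann hierarchy *)

Lemma ackFSS k x : ackF k.+2 x.+1 = ackF k.+1 (ackF k.+2 x).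
Proof. by []. Qed.

Lemma ackF_gt0 k x : 0 < ackF k.+2 x.
Proof.
elim: x => // x IH; rewrite ackFSS.
exact: leq_trans IH (ltnW (ackF_gt k IH)).
Qed.

Section Level.
Variables (M s D : nat).
Hypothesis D_gt0 : 0 < D.
Hypothesis weight_lower : forall u, ffree s.+1 u -> size u <= M ->
  weight u <= D * (#|letters u| + size u).

(** With [g] global letters, [j] groups and [m] blocks, the global part costs at most
    [D * C * (g + t * j) + 2 * D * m]. As [t * j <= 2 * m] and [1 <= C], this is at most
    [D * C * g + 4 * D * C * m]: hence the factor 4 and the passage from [x] to [x.+1]. *)
Lemma weight_split_groups (C t x : nat) ws :
    (forall w, w \in ws -> size w <= M) ->
    (forall w, w \in ws -> weight (restr (~: global ws) w)
       <= 4 * D * C * (#|letters w :&: ~: global ws| + x * size w)) ->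
    weight (restr (global ws) (map letters ws))
       <= C * (#|global ws| + t * size ws) ->
    size ws * t <= 2 * size (flatten ws) -> 0 < C ->
    ffree s.+2 (flatten ws) ->
  weight (flatten ws)
    <= 4 * D * C * (#|letters (flatten ws)| + x.+1 * size (flatten ws)).
Proof.
move=> le_M local_le glob_le le_t C_gt0 free.
have groups_le : weight (flatten ws) <=
    4 * D * C * (\sum_(w <- ws) #|letters w :&: ~: global ws|
                 + x * size (flatten ws))
    + D * (weight (restr (global ws) (map letters ws)) + 2 * size (flatten ws)).
  rewrite weight_flatten /weight !big_map size_flatten sumnE !big_map.
  rewrite !big_distrr /= -!big_split /= !big_distrr /= -big_split /=.
  rewrite !big_seq; apply: leq_sum => w ws_w.
  apply: leq_trans (weight_group weight_lower free ws_w (le_M w ws_w)) _.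
  by rewrite leq_add2r local_le.
have := card_local ws; move: groups_le glob_le le_t C_gt0 D_gt0.
move: (weight (flatten ws)) (weight (restr _ _)) (size (flatten ws)) (size ws).
move: (\sum_(w <- ws) _) #|global ws| #|letters _| => a g n tot tg m j.
move=> tot_le tg_le le_m C0 D0 le_n.
have tg_le' : D * tg <= D * (C * (g + t * j)) by rewrite leq_mul2l tg_le orbT.
have le_m' : D * C * (j * t) <= D * C * (2 * m) by rewrite leq_mul2l le_m orbT.
have le_n' : 4 * D * C * (a + g) <= 4 * D * C * n.
  by rewrite leq_mul2l le_n orbT.
have le_Dm : D * m <= D * C * m by rewrite leq_mul2r leq_pmulr ?orbT.
nia.
Qed.

(* The hypothesis [size w * t < ackF k.+1 t + t] is what a cut into groups of
   size [t] of a word of at most [ackF k.+1 t] blocks provides.  At [k = 0] it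
   leaves only two groups, so the recursion can start from the trivial bound. *)
Lemma weight_ack_step k :
    (forall t w, 0 < t -> size w * t < ackF k.+1 t + t -> size w <= M ->
       ffree s.+2 w ->
       weight w <= 2 * (4 * D) ^ k * (#|letters w| + t * size w)) ->
  forall x w, size w <= ackF k.+2 x -> size w <= M -> ffree s.+2 w ->
    weight w <= 2 * (4 * D) ^ k.+1 * (#|letters w| + x * size w).
Proof.
move=> IHk; elim=> [|x IHx] w.
  (* [ackF k.+2 0] is 1, so there is at most one block. *)
  move=> le_w1 _ _; apply: leq_trans (weight_le_letters w) _.
  rewrite mul0n addn0 mulnC leq_mul //; apply: leq_trans le_w1 _.
  by rewrite muln_gt0 expn_gt0 muln_gt0 D_gt0.
(* With groups of size [t], the induction on [x] handles the local letters inside each group, and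
   [IHk] handles the word of groups, which is short enough because [size w <= ackF k.+1 t]. *)
rewrite ackFSS; set t := ackF k.+2 x => le_wF le_wM free.
have [le_wt|lt_tw] := leqP (size w) t.
  apply: leq_trans (IHx w le_wt le_wM free) _.
  by rewrite leq_mul2l leq_add2l leq_mul2r leqnSn !orbT.
have t_gt0 : 0 < t := ackF_gt0 k x.
have [ws [def_w le_t lt_ws]] := chunks w t_gt0.
have le_ws : size ws <= size w.
  rewrite -ltnS -(ltn_pmul2r t_gt0); apply: leq_trans lt_ws _.
  by rewrite mulSn addnC leq_add2l leq_pmulr.
have def_C : 2 * (4 * D) ^ k.+1 = 4 * D * (2 * (4 * D) ^ k).
  by rewrite expnS mulnCA.
rewrite {1}def_C -def_w.
apply: (@weight_split_groups (2 * (4 * D) ^ k) t x); rewrite ?def_w //.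
- by move=> u /le_t le_ut; apply: leq_trans le_ut (leq_trans (ltnW lt_tw) le_wM).
- move=> u ws_u; rewrite -letters_restr -def_C.
  have free_u : ffree s.+2 u.
    case/splitPr: ws_u def_w => pre post; rewrite flatten_cat /= => def_w.
    by apply: (@ffree_infix _ (flatten pre) u (flatten post)); rewrite def_w.
  have := IHx (restr (~: global ws) u); rewrite size_map; apply.
  + exact: le_t.
  + exact: leq_trans (le_t u ws_u) (leq_trans (ltnW lt_tw) le_wM).
  + exact: ffree_restr.
- have := IHk t (restr (global ws) (map letters ws)) t_gt0.
  rewrite letters_global !size_map; apply.
  + by apply: leq_trans lt_ws _; rewrite leq_add2r.
  + exact: leq_trans le_ws le_wM.
  + by apply/ffree_restr/ffree_contract; rewrite def_w.
- by apply: leq_trans (ltnW lt_ws) _; rewrite mul2n -addnn leq_add2l ltnW.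
- by rewrite muln_gt0 expn_gt0 muln_gt0 D_gt0.
Qed.

Lemma weight_level k t w :
    0 < t -> size w * t < ackF k.+1 t + t -> size w <= M -> ffree s.+2 w ->
  weight w <= 2 * (4 * D) ^ k * (#|letters w| + t * size w).
Proof.
elim: k t w => [|k IHk] t w t_gt0 lt_wt le_wM free.
  have le_w2 : size w <= 2.
    by rewrite -ltnS -(ltn_pmul2r t_gt0) mulSn addnC.
  apply: leq_trans (weight_le_letters w) _; rewrite expn0 muln1 mulnC leq_mul //.
  exact: leq_addr.
(* As [0 < t], the hypothesis on [size w * t] implies [size w <= ackF k.+2 t]. *)
by apply: weight_ack_step => //; nia.
Qed.

Lemma weight_ack k x w :
    size w <= ackF k.+2 x -> size w <= M -> ffree s.+2 w ->
  weight w <= 2 * (4 * D) ^ k.+1 * (#|letters w| + x * size w).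
Proof. by apply: weight_ack_step => t u; apply: weight_level. Qed.

End Level.

Fixpoint weightC k x s : nat :=
  if s is s'.+1 then x * (2 * (4 * weightC k x s') ^ k.+1) else r.

Lemma weightC_gt0 k x s : 0 < r -> 0 < x -> 0 < weightC k x s.
Proof.
move=> r_gt0 x_gt0; elim: s => //= s IH.
by rewrite !muln_gt0 x_gt0 expn_gt0 muln_gt0 IH.
Qed.

(** The same [k] and [x] serve every [s], since groups and contracted words never have more than [M]
    blocks. The induction starts from [r] because a word without a single interval has fewer than
    [r] letters. *)
Lemma weight_bound M k x s w : 0 < r -> 0 < x -> M <= ackF k.+2 x ->
    ffree s.+1 w -> size w <= M ->
  weight w <= weightC k x s * (#|letters w| + size w).
Proof.
move=> r_gt0 x_gt0 le_M; elim: s w => [|s IH] w free le_wM.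
  apply: leq_trans (weight_le_letters w) _.
  by rewrite leq_mul ?leq_addl // ltnW // ffree1_card.
have C_gt0 := weightC_gt0 k s r_gt0 x_gt0.
apply: leq_trans (weight_ack C_gt0 IH (leq_trans le_wM le_M) le_wM free) _.
by rewrite /= [x * (2 * _)]mulnC -[leqRHS]mulnA leq_mul2l mulnDr leq_add2r leq_pmull ?orbT.
Qed.

(** * Greedy segments and removal of the number of blocks *)

Lemma greedy_segments (A : eqType) (P : pred (seq A)) (xs : seq A) : P [::] ->
  exists xss zs, [/\ xs = flatten xss ++ zs, P zs
    & forall ys, ys \in xss ->
        ~~ P ys /\ exists ys' y, ys = rcons ys' y /\ P ys'].
Proof.
move=> P0; elim/last_ind: xs => [|xs x [xss [zs [-> Pzs Pxss]]]].
  by exists [::], [::].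
have [Pzx|nPzx] := boolP (P (rcons zs x)).
  by exists xss, (rcons zs x); rewrite rcons_cat.
exists (rcons xss (rcons zs x)), [::]; split=> // [|ys].
  by rewrite cats0 flatten_rcons rcons_cat.
rewrite mem_rcons inE => /orP[/eqP->|/Pxss//].
by split=> //; exists zs, x.
Qed.

(* Each segment carries the first occurrence of some letter: otherwise the
   preceding segments would extend its formation by one more interval. *)
Lemma size_segments s ws : ffree s.+2 (flatten ws) ->
    (forall u, u \in ws -> ~~ ffree s.+1 u) ->
  size ws <= #|letters (flatten ws)|.
Proof.
elim/last_ind: ws => // ws u IH; rewrite flatten_rcons => free nfree.
have /forallPn[R] : ~~ ffree s.+1 u by rewrite nfree // mem_rcons mem_head.
rewrite negb_imply negbK => /andP[/eqP cR fR].
rewrite size_rcons letters_cat; apply: leq_ltn_trans (IH _ _) _.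
- exact: (@ffree_infix _ [::] _ u).
- by move=> v ws_v; rewrite nfree // mem_rcons mem_behead.
apply: proper_card; rewrite properUl //; apply/negP => uS.
have := ffreeP _ _ free R cR; apply/negP; rewrite negbK.
apply: formation_consl => //.
exact: subset_trans (formation_sub_letters fR) uS.
Qed.

(** The truncated subtraction sets aside [r.-1] letters per block, which become the term
    [(q - 1) * hv H]. What remains can be bounded by the number of letters alone. *)
Definition excess w : nat := \sum_(B <- w) (#|B| - r.-1).

Lemma excess_le_weight w : excess w <= weight w.
Proof. by apply: leq_sum => B _; rewrite leq_subr. Qed.

Lemma weight_le_excess w : weight w <= r.-1 * size w + excess w.
Proof.
rewrite mulnC -sum1_size big_distrl /= -big_split /=.
by apply: leq_sum => B _; rewrite mul1n -leq_subLR.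
Qed.

Fixpoint excessC (D : nat -> nat) s : nat :=
  if s is s'.+1 then (excessC D s').+1 * (3 * D s') else 0.

(** Without its last block a greedy segment obeys the bound for [s], and that block adds at most the
    letters of the segment: hence [(excessC D s).+1]. The letter counts of the segments sum to the
    weight of the contracted word, to which [D] applies. *)
Lemma excess_bound (D : nat -> nat) M s w : 0 < r ->
    (forall s' u, ffree s'.+2 u -> size u <= M ->
       weight u <= D s' * (#|letters u| + size u)) ->
    #|T| < M -> ffree s.+1 w ->
  excess w <= excessC D s * #|letters w|.
Proof.
move=> r_gt0 le_D lt_TM; elim: s w => [|s IH] w free.
  rewrite mul0n leqn0 /excess big_seq big1 // => B /sub_letters/subset_leq_card.
  by move/leq_ltn_trans/(_ (ffree1_card free)) => ?; apply/eqP; lia.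
have [w0|n_gt0] := posnP #|letters w|.
  by rewrite (leq_trans (excess_le_weight w)) // (leq_trans (weight_le_letters w)) // w0.
have free0 : ffree s.+1 [::].
  apply/ffreeP=> R cR; apply/negP=> /formation_sub_letters.
  by rewrite /letters big_nil subset0 -cards_eq0 cR => /eqP r0; rewrite r0 in r_gt0.
have [ws [z [def_w free_z Hws]]] := greedy_segments w free0.
have le_ws : size ws <= #|letters w|.
  have: size ws <= #|letters (flatten ws)|.
    apply: (@size_segments s) => [|u /Hws[]//].
    by apply: (@ffree_infix _ [::] _ z); rewrite -def_w.
  by move/leq_trans; apply; rewrite def_w letters_cat subset_leq_card ?subsetUl.
set vs := rcons ws z; have def_vs : flatten vs = w by rewrite flatten_rcons def_w.
have size_vs : size vs = (size ws).+1 by rewrite size_rcons.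
have le_vs u : u \in vs -> excess u <= (excessC D s).+1 * #|letters u|.
  rewrite mem_rcons inE => /orP[/eqP->|/Hws[_ [u' [B [-> free_u']]]]].
    by rewrite (leq_trans (IH z free_z)) // leq_mul2r leqnSn orbT.
  rewrite /excess big_rcons /= -/(excess u') mulSn.
  rewrite -cats1 letters_cat /letters big_seq1 -/(letters u').
  rewrite addnC leq_add //.
    by rewrite (leq_trans (leq_subr _ _)) // subset_leq_card ?subsetUr.
  rewrite (leq_trans (IH u' free_u')) // leq_mul2l subset_leq_card ?subsetUl //.
  by rewrite orbT.
have -> : excess w = \sum_(u <- vs) excess u.
  rewrite -def_vs; elim: (vs) => [|u us IHus]; first by rewrite /excess !big_nil.
  by rewrite big_cons -IHus /excess big_cat.
have le_sum : \sum_(u <- vs) excess u <=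
    (excessC D s).+1 * weight (map letters vs).
  by rewrite /weight big_map big_distrr !big_seq; apply: leq_sum.
apply: leq_trans le_sum _; rewrite /= -mulnA leq_mul2l /=.
have free_vs : ffree s.+2 (map letters vs) by apply: ffree_contract; rewrite def_vs.
have le_T : #|letters w| <= #|T| := max_card _.
(* For [n] letters there are at most [n + 1] segments, the leftover [z] included, and
   [n + (n + 1) <= 3 * n] as [0 < n]. The extra segment is why [M] must exceed [#|T|]. *)
apply: leq_trans (le_D _ _ free_vs _) _; rewrite size_map size_vs; first lia.
by rewrite letters_flatten def_vs -mulnA mulnCA leq_mul2l; lia.
Qed.

End Blocks.

(** * Numerical estimates and comparison with [beta] *)

Lemma leq_exp2r_homo (m n e : nat) : m <= n -> m ^ e <= n ^ e.
Proof. by case: e => // e le_mn; rewrite leq_exp2r. Qed.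

Lemma expn_le_mul8 (Y e : nat) : 0 < e -> 8 * Y ^ e <= (8 * Y) ^ e.
Proof.
by move=> e_gt0; rewrite expnMn leq_mul2r -{1}(expn1 8) leq_exp2l // e_gt0 orbT.
Qed.

(** With [a = k.+2], one step of [weightC] takes [D] to at most [2 ^ a * (4 * D) ^ a = (8 * D) ^ a].
    Each step thus multiplies the base by 8 and the exponent by [a]. *)
Lemma weightC_le (r k x s : nat) : 0 < r -> x <= 2 ^ k.+2 ->
  weightC r k x s <= (8 ^ s * r) ^ (k.+2 ^ s).
Proof.
move=> r_gt0 le_x; elim: s => [|s IH]; first by rewrite mul1n expn1.
set a := k.+2 in le_x *; rewrite /=; set D := weightC r k x s in IH *.
set Y := 8 ^ s * r in IH *.
have Y_gt0 : 0 < Y by rewrite muln_gt0 expn_gt0.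
have as_gt0 : 0 < a ^ s by rewrite expn_gt0.
apply: (@leq_trans (2 ^ a * (4 * Y ^ (a ^ s)) ^ a)).
  rewrite leq_mul // [leqRHS]expnS leq_mul //.
    by rewrite (leq_trans _ (leq_pmulr 4 _)) ?expn_gt0 ?Y_gt0.
  by rewrite leq_exp2r // leq_mul2l IH orbT.
rewrite -expnMn (mulnA 2) (expnSr a) expnM leq_exp2r // (expnS 8) -(mulnA 8).
exact: expn_le_mul8.
Qed.

Lemma excessC_le (r k x s : nat) : 0 < r -> 0 < x <= 2 ^ k.+2 ->
  excessC (fun s' => weightC r k x s'.+1) s
    < (8 ^ s.+1 * r) ^ (s * k.+2 ^ s).
Proof.
move=> r_gt0 /andP[x_gt0 le_x]; elim: s => [|s IH] //.
set a := k.+2 in le_x IH *; set Y := 8 ^ s.+1 * r in IH *.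
have Y_gt0 : 0 < Y by rewrite muln_gt0 expn_gt0.
have as_gt0 : 0 < a ^ s.+1 by rewrite expn_gt0.
have D_gt0 := @weightC_gt0 r k x s.+1 r_gt0 x_gt0.
have D_le := @weightC_le r k x s.+1 r_gt0 le_x.
rewrite -/a -/Y in D_le; set D := weightC r k x s.+1 in D_gt0 D_le.
set E := excessC _ s in IH.
change (E.+1 * (3 * D) < (8 ^ s.+2 * r) ^ (s.+1 * a ^ s.+1)).
apply: (@leq_trans (E.+1 * (4 * D))).
  by rewrite ltn_pmul2l // ltn_pmul2r.
rewrite (expnS 8 s.+1) -(mulnA 8) -/Y (mulSn s) addnC expnD leq_mul //.
  apply: leq_trans IH _.
  apply: (@leq_trans (Y ^ (s * a ^ s.+1))).
    by rewrite leq_pexp2l // leq_mul2l leq_pexp2l ?orbT.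
  by rewrite leq_exp2r_homo ?leq_pmull.
apply: leq_trans (expn_le_mul8 Y as_gt0); exact: leq_mul.
Qed.

(* The value [3] bounds the number of blocks when [alpha n = 1], i.e. [n <= 2]. *)
Lemma excessC_const3 s : excessC (fun=> 3) s < 16 ^ s.
Proof. by elim: s => // s IH; rewrite expnS /=; lia. Qed.

Lemma alphaP n : 0 < alpha n /\ n <= ackA (alpha n).
Proof. by rewrite /alpha; case: ex_minnP => m /andP[]. Qed.

Lemma excess_lt_beta (T : finType) (q s : nat) (w : seq {set T}) :
    1 < q -> 0 < #|T| -> ffree q s.+1 w ->
  excess q w < #|T| * beta q (2 * s.+1) #|T|.
Proof.
move=> q_gt1 T_gt0 free; have q_gt0 := ltnW q_gt1.
have [a_gt0 le_TA] := alphaP #|T|.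
suff [E le_E lt_E] : exists2 E, excess q w <= E * #|letters w|
                              & E < beta q (2 * s.+1) #|T|.
  have : E * #|letters w| <= E * #|T| by rewrite leq_mul2l max_card orbT.
  by move/(leq_trans le_E)/leq_ltn_trans; apply; rewrite mulnC ltn_pmul2l.
have le_K : 4 * s.+1 <= q * (2 * s.+1).
  by rewrite [leqRHS]mulnA leq_mul2r (leq_mul2r 2 2 q) q_gt1 orbT.
rewrite /beta; move: (alpha _) a_gt0 le_TA => [|[|k]] // _ le_TA.
  exists (excessC (fun=> 3) s).
    apply: (@excess_bound _ _ _ 3) => // s' u _ le_u3.
    rewrite (leq_trans (weight_le_letters u)) // mulnC leq_mul //; lia.
  apply: leq_trans (excessC_const3 s) _; rewrite (_ : 16 = 2 ^ 4) // -expnM -mulnA mulnCA.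
  rewrite (leq_trans _ (leq_pmulr _ _)) ?leq_pexp2l //; first lia.
  by rewrite muln_gt0 q_gt0 expn_gt0 muln_gt0 q_gt0.
(* Here [alpha] is [k.+2]. Taking [k.+3] for [x] makes [ackF k.+2 x] strictly larger than
   [ackA k.+2], which leaves room for [#|T|.+1] blocks. *)
exists (excessC (fun s' => weightC q k k.+3 s'.+1) s).
  apply: (@excess_bound _ _ _ #|T|.+1) => // s' u free_u le_u.
  apply: (@weight_bound _ _ #|T|.+1) => //.
  by rewrite ackFSS (leq_ltn_trans le_TA) // ackF_gt // ackF_gt0.
have lt_k : k.+3 <= 2 ^ k.+2 by rewrite ltn_expl.
apply: leq_trans (@excessC_le q k k.+3 s q_gt0 _) _; first by rewrite lt_k.
set a := k.+2; set K := q * _ in le_K *.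
have q10_gt0 : 0 < 10 * q by rewrite muln_gt0.
apply: (@leq_trans ((10 * q) ^ (2 * a ^ (K - 4) + 8 * a ^ (K - 5)))); last first.
  by rewrite leq_pmull // muln_gt0 q_gt0 expn_gt0.
apply: (@leq_trans ((10 * q) ^ (s.+1 * (s * a ^ s)))).
  rewrite [leqRHS]expnM leq_exp2r_homo // expnMn leq_mul //.
    by rewrite leq_exp2r_homo.
  by rewrite -{1}(expn1 q) leq_pexp2l.
(* From [s.+1 * s <= 4 ^ s] and [2 <= a] the exponent is at most [a ^ (4 * s)], and [4 * s <= K - 4]
   by [le_K]. *)
rewrite leq_pexp2l // (leq_trans _ (leq_addr _ _)) //.
rewrite (leq_trans _ (leq_pmull _ _)) // mulnA.
apply: (@leq_trans (a ^ (3 * s) * a ^ s)); last first.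
  by rewrite -expnD leq_pexp2l //; lia.
rewrite leq_mul2r; apply/orP; right.
apply: (@leq_trans (2 ^ (3 * s))); last by rewrite leq_exp2r_homo.
apply: (@leq_trans (2 ^ s * 2 ^ s)).
  by apply: leq_mul; last apply: ltnW; apply: ltn_expl.
by rewrite -expnD leq_pexp2l //; lia.
Qed.

(** * From hypergraphs to words *)

Definition blocks (H : hypergraph) : seq {set hindex H} :=
  [seq [set i | v \in H i] | v <- sort leq (hvert H)].

Lemma size_blocks (H : hypergraph) : size (blocks H) = hv H.
Proof. by rewrite size_map size_sort. Qed.

Lemma hedge_sub (H : hypergraph) (i : hindex H) : {subset H i <= hvert H}.
Proof. by move=> v vi; apply/bigfcupP; exists i; rewrite ?mem_index_enum. Qed.

Lemma weight_blocks (H : hypergraph) : weight (blocks H) = hi H.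
Proof.
rewrite /weight big_map (perm_big _ (permEl (perm_sort _ _))) /=.
under eq_bigr => v _ do rewrite -sum1_card big_mkcond /=.
rewrite exchange_big; apply: eq_bigr => i _ /=.
under eq_bigr => v _ do rewrite inE.
rewrite -big_mkcond sum1_count -size_filter; apply/perm_size/uniq_perm.
- exact/filter_uniq/fset_uniq.
- exact: fset_uniq.
move=> v; rewrite mem_filter; apply: andb_idr; exact: hedge_sub.
Qed.

Lemma formation_hcontains (F H : hypergraph) (R : {set hindex H}) :
    is_partition F -> 0 < he F -> #|R| = he F ->
    formation (hv F) R (blocks H) ->
  hcontains H F.
Proof.
move=> partF F_gt0 cR.
pose f (i : hindex F) := enum_val (cast_ord (esym cR) (enum_rank i)).
have f_inj : injective f by move=> i j /enum_val_inj/cast_ord_inj/enum_rank_inj.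
have [i0 _] : exists i0 : hindex F, true by case/card_gt0P: F_gt0 => i0; exists i0.
(* [e v] is the edge through [v], unique by disjointness. The default [i0] makes it total, as
   [formation_choice] asks for a letter at every index. *)
pose e v := odflt i0 [pick i | v \in F i].
have eE i v : v \in F i -> e v = i.
  rewrite /e; case: pickP => [j /= vj vi|/(_ i)->//].
  apply/eqP/negPn/negP => /partF/fdisjointP/(_ v vj); by rewrite vi.
pose vs := sort leq (hvert F); pose us := sort leq (hvert H).
case/(formation_choice (c := fun j => f (e (nth 0 vs j)))) => [j|pos].
  exact: enum_valP.
rewrite size_map -/us => -[pos_mono pos_lt pos_in].
have mem_vs v : v \in hvert F -> v \in vs by rewrite mem_sort.
have index_lt v : v \in hvert F -> index v vs < hv F.
  by move/mem_vs; rewrite -index_mem size_sort.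
have sorted_leq (V : {fset nat}) : sorted leq (sort leq V).
  by apply: sort_sorted; apply: leq_total.
have phi_in (v : hvert F) : nth 0 us (pos (index (val v) vs)) \in hvert H.
  by rewrite -(mem_sort leq) mem_nth // pos_lt // index_lt // (valP v).
exists (fun v => [` phi_in v]%fset), f; split=> // [x y lt_xy|i v vi] /=.
  have [lt_x lt_y] := (index_lt _ (valP x), index_lt _ (valP y)).
  rewrite (sorted_ltn_nth ltn_trans) ?inE ?pos_lt //;
    first by rewrite ltn_sorted_uniq_leq sort_uniq fset_uniq sorted_leq.
  apply: pos_mono; rewrite lt_y andbT ltnNge; apply/negP => le_yx.
  move: lt_xy; rewrite ltnNge => /negP; apply.
  by apply: (sorted_leq_index leq_trans leqnn (sorted_leq _)) le_yx;
    rewrite mem_vs ?(valP x) ?(valP y).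
have lt_v := index_lt _ (valP v).
have := pos_in _ lt_v; rewrite nth_index ?mem_vs ?(valP v) // (eE _ _ vi).
by rewrite (nth_map 0) ?inE // pos_lt.
Qed.

Theorem theorem5 (F H : hypergraph) (p q : nat)
    (partF : is_partition F) (defp : p = hv F) (defq : q = he F)
    (q_gt1 : 1 < q) (H_neq0 : 0 < he H) (freeH : hfree F H) :
  hi H < (q - 1) * hv H + he H * beta q (2 * p) (he H).
Proof.
have F_gt0 : 0 < he F by rewrite -defq ltnW.
have p_gt0 : 0 < p.
  rewrite defp cardfs_gt0; have [i _] := card_gt0P F_gt0.
  have /fset0Pn[v vi] := hedge_neq0 i.
  by apply/fset0Pn; exists v; apply: hedge_sub vi.
have free : ffree q p (blocks H).
  apply/ffreeP=> R cR; apply/negP=> fR; apply: freeH.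
  by apply: (formation_hcontains partF F_gt0 (etrans cR defq)); rewrite -defp.
rewrite -weight_blocks -size_blocks subn1.
apply: leq_ltn_trans (weight_le_excess q _) _; rewrite ltn_add2l.
by case: p p_gt0 free {defp} => // s _; apply: excess_lt_beta.
Qed.
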